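(* The real $q$-linked Minkowski space $(\mathcal M^{\ell,q}_{\mathbb C},\star_{\mathrm m})$ is a quantum homogeneous space with respect to the coaction $\rho$ of the quantum group $\mathrm{SO}_q^{\ell}(3,1)=(G,\star_{\mathrm l})$; in other words, with the notation of the context, $$\rho\circ\star_{\mathrm m}=(\star_{\mathrm l}\otimes\star_{\mathrm m})\circ\rho .$$
   Context: Parameters: $q,\ell$ are nonzero real numbers, i.e. $\bar q=q$, $\bar\ell=\ell$ (or invertible indeterminates over $\mathbb C$, with complex conjugation extended to the ground ring $\mathbb C[q^{\pm1},\ell^{\pm1}]$ by $\bar q=q$, $\bar\ell=\ell$). A star structure on an algebra is an antilinear, antimultiplicative, unital involution. $\mathcal M^{\ell,q}_{\mathbb C}$ is the associative unital algebra generated by $t_{11},t_{12},t_{21},t_{22}$ with relations $$t_{11}t_{12}=q\ell\,t_{12}t_{11},\quad t_{12}t_{22}=q^{-1}\ell\,t_{22}t_{12},\quad t_{12}t_{21}=t_{21}t_{12}+\ell(q^{-1}-q)t_{11}t_{22},$$ $$t_{11}t_{22}=t_{22}t_{11},\quad t_{11}t_{21}=q^{-1}\ell^{-1}t_{21}t_{11},\quad t_{21}t_{22}=q\ell^{-1}t_{22}t_{21}.$$ $G=\mathrm{SL}_q^{(s)}(2,\mathbb C)\stackrel{\ell}{\oplus}\mathrm{SL}_q^{(s)}(2,\mathbb C)$ is the associative unital algebra generated by the entries of $x=(x_{ij})=\begin{pmatrix}a&b\\c&d\end{pmatrix}$ and $y=(y_{ij})=\begin{pmatrix}a'&b'\\c'&d'\end{pmatrix}$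 with relations: (i) $ab=q^{-1}ba$, $ac=q^{-1}ca$, $bd=q^{-1}db$, $cd=q^{-1}dc$, $ad-da=(q^{-1}-q)bc$, $bc=cb$, $ad-q^{-1}bc=1$; (ii) the same relations (same $q$) for $a',b',c',d'$; (iii) link relations: $b'a=\ell ab'$, $ac'=\ell c'a$, $a'b=\ell ba'$, $bd'=\ell d'b$, $ca'=\ell a'c$, $d'c=\ell cd'$, $db'=\ell b'd$, $c'd=\ell dc'$, and $aa'=a'a$, $ad'=d'a$, $bb'=b'b$, $bc'=c'b$, $cb'=b'c$, $cc'=c'c$, $da'=a'd$, $dd'=d'd$. It is a Hopf algebra with matrix coproduct $\Delta(x_{ij})=\sum_k x_{ik}\otimes x_{kj}$, $\Delta(y_{ij})=\sum_k y_{ik}\otimes y_{kj}$ and antipode $S(x)=\begin{pmatrix}d&-qb\\-q^{-1}c&a\end{pmatrix}$, $S(y)=\begin{pmatrix}d'&-qb'\\-q^{-1}c'&a'\end{pmatrix}$. Coaction: $\rho:\mathcal M^{\ell,q}_{\mathbb C}\to G\otimes\mathcal M^{\ell,q}_{\mathbb C}$ is the algebra homomorphism with $\rho(t_{ij})=\sum_{s,r}y_{is}S(x_{rj})\otimes t_{sr}$. Star structures: $\star_{\mathrm m}$ on $\mathcal M^{\ell,q}_{\mathbb C}$ is given by $t_{ij}\mapsto t_{ji}$. $\star_{\mathrm l}$ on $G$ is given by $x_{ij}^{\star_{\mathrm l}}=S(y_{ji})$ and $y_{ij}^{\star_{\mathrm l}}=S(x_{ji})$; explicitly $a\mapsto d'$,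 $b\mapsto -q^{-1}c'$, $c\mapsto -qb'$, $d\mapsto a'$, $a'\mapsto d$, $b'\mapsto -q^{-1}c$, $c'\mapsto -qb$, $d'\mapsto a$. *)

(* Defs.v *)
From HB Require Import structures.
From mathcomp Require Import all_boot all_order all_algebra.
From mathcomp Require Import boolp reals.
From mathcomp Require Import complex.

Set Implicit Arguments.
Unset Strict Implicit.
Unset Printing Implicit Defensive.

Import GRing.Theory.
Local Open Scope ring_scope.
Local Open Scope quotient_scope.

(* Associative unital algebras over [k], given as rings with a central ring
   morphism from [k]. The library's [algType] cannot be used since it requires
   [1 != 0], which is not part of the definition of an algebra given by
   generators and relations, and its hierarchy does not allow a structure
   joining [lmodType] and [pzRingType]. *)
HB.mixin Record PzRing_isAlgebra (k : comPzRingType) A of GRing.PzRing A := {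
  emb : k -> A;
  embD : forall c d : k, emb (c + d) = emb c + emb d;
  embM : forall c d : k, emb (c * d) = emb c * emb d;
  emb1 : emb 1 = 1;
  embC : forall (c : k) (x : A), emb c * x = x * emb c
}.

#[short(type="algebraType")]
HB.structure Definition AlgebraOver (k : comPzRingType) :=
  {A of GRing.PzRing A & PzRing_isAlgebra k A}.

Definition scale (k : comPzRingType) (A : algebraType k) (c : k) (x : A) : A :=
  emb c * x.
Notation "c *' x" := (scale c x) (at level 40, format "c  *'  x") : ring_scope.

Lemma emb0 (k : comPzRingType) (A : algebraType k) : emb 0 = 0 :> A.
Proof. by apply: (addIr (emb 0)); rewrite -embD !add0r. Qed.

Lemma embN (k : comPzRingType) (A : algebraType k) c :
  emb (- c) = - emb c :> A.
Proof. by apply: (addIr (emb c)); rewrite -embD !addNr emb0. Qed.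

(* [sigma]-semilinear maps; complex conjugation gives the antilinear ones. *)
Definition semilinear_map (k : comPzRingType) (A B : algebraType k)
    (sigma : k -> k) (f : A -> B) : Prop :=
  (forall x y, f (x + y) = f x + f y) /\
  (forall c x, f (c *' x) = sigma c *' f x).

Definition algebra_hom (k : comPzRingType) (A B : algebraType k)
    (f : A -> B) : Prop :=
  [/\ semilinear_map idfun f, forall x y, f (x * y) = f x * f y & f 1 = 1].

Definition star_structure (k : comPzRingType) (conj : k -> k)
    (A : algebraType k) (f : A -> A) : Prop :=
  [/\ semilinear_map conj f, forall x y, f (x * y) = f y * f x, f 1 = 1
    & involutive f].

Section Expressions.
Variables (k : comPzRingType) (X : Type).

Inductive expr : Type :=
| Const of k
| Gen of X
| Add of expr & expr
| Mul of expr & expr.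

HB.instance Definition _ := gen_eqMixin expr.
HB.instance Definition _ := gen_choiceMixin expr.

Definition Sub (u v : expr) : expr := Add u (Mul (Const (- 1)) v).

(* A presentation is a list of pairs of expressions to be identified. *)
Definition relations := seq (expr * expr).

(* The least congruence which makes the expressions an associative unital
   algebra and contains the given relations. *)
Inductive cong (R : relations) : expr -> expr -> Prop :=
| cong_refl u : cong R u u
| cong_sym u v : cong R u v -> cong R v u
| cong_trans u v w : cong R u v -> cong R v w -> cong R u w
| cong_Add u u' v v' :
    cong R u u' -> cong R v v' -> cong R (Add u v) (Add u' v')
| cong_Mul u u' v v' :
    cong R u u' -> cong R v v' -> cong R (Mul u v) (Mul u' v')
| cong_addA u v w : cong R (Add u (Add v w)) (Add (Add u v) w)
| cong_addC u v : cong R (Add u v) (Add v u)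
| cong_add0 u : cong R (Add (Const 0) u) u
| cong_mul0 u : cong R (Mul (Const 0) u) (Const 0)
| cong_mulA u v w : cong R (Mul u (Mul v w)) (Mul (Mul u v) w)
| cong_mul1l u : cong R (Mul (Const 1) u) u
| cong_mulDl u v w : cong R (Mul (Add u v) w) (Add (Mul u w) (Mul v w))
| cong_mulDr u v w : cong R (Mul u (Add v w)) (Add (Mul u v) (Mul u w))
| cong_constD c d : cong R (Add (Const c) (Const d)) (Const (c + d))
| cong_constM c d : cong R (Mul (Const c) (Const d)) (Const (c * d))
| cong_constC c u : cong R (Mul (Const c) u) (Mul u (Const c))
| cong_rel u v : (u, v) \in R -> cong R u v.

Section Evaluation.
Variables (A : algebraType k) (anti : bool) (sigma : {rmorphism k -> k}).
Variable f : X -> A.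

(* If [anti] holds, the order of the factors of products is reversed. *)
Fixpoint eval (e : expr) : A :=
  match e with
  | Const c => emb (sigma c)
  | Gen x => f x
  | Add u v => eval u + eval v
  | Mul u v => if anti then eval v * eval u else eval u * eval v
  end.

Definition satisfies (R : relations) : Prop :=
  forall r, r \in R -> eval r.1 = eval r.2.

Lemma eval_cong R u v : satisfies R -> cong R u v -> eval u = eval v.
Proof.
move=> HR; elim=> {u v} /=.
- by [].
- by move=> u v _ ->.
- by move=> u v w _ -> _ ->.
- by move=> u u' v v' _ -> _ ->.
- by move=> u u' v v' _ -> _ ->.
- by move=> u v w; rewrite addrA.
- by move=> u v; rewrite addrC.
- by move=> u; rewrite rmorph0 emb0 add0r.
- by move=> u; rewrite rmorph0 emb0; case: anti; rewrite ?mulr0 ?mul0r.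
- by move=> u v w; case: anti; rewrite mulrA.
- by move=> u; rewrite rmorph1 emb1; case: anti; rewrite ?mulr1 ?mul1r.
- by move=> u v w; case: anti; rewrite ?mulrDl ?mulrDr.
- by move=> u v w; case: anti; rewrite ?mulrDl ?mulrDr.
- by move=> c d; rewrite rmorphD embD.
- by move=> c d; rewrite rmorphM embM; case: anti; rewrite // embC.
- by move=> c u; case: anti; rewrite embC.
- by move=> u v /HR.
Qed.

End Evaluation.
End Expressions.

Arguments Gen {k X}.
Arguments Const {k X}.

Declare Scope expr_scope.
Delimit Scope expr_scope with expr.
Bind Scope expr_scope with expr.
Notation "u + v" := (Add u v) : expr_scope.
Notation "u - v" := (Sub u v) : expr_scope.
Notation "u * v" := (Mul u v) : expr_scope.
Notation "c %:c" := (Const c) (at level 2, format "c %:c") : expr_scope.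
Notation "u === v" := (u%expr, v%expr) (at level 70, only parsing).

(* The associative unital algebra with generators [X] and relations [R]. *)
Section Presented.
Variables (k : comPzRingType) (X : Type) (R : relations k X).

Definition congb (u v : expr k X) : bool := `[< cong R u v >].

Lemma congb_refl : reflexive congb.
Proof. by move=> u; apply/asboolP; exact: cong_refl. Qed.
Lemma congb_sym : symmetric congb.
Proof. by move=> u v; apply/asboolP/asboolP => /cong_sym. Qed.
Lemma congb_trans : transitive congb.
Proof.
move=> v u w /asboolP uv /asboolP vw; apply/asboolP.
exact: cong_trans uv vw.
Qed.
Canonical congb_equiv := EquivRel congb congb_refl congb_sym congb_trans.

Definition presented := {eq_quot congb_equiv}.
HB.instance Definition _ := Choice.on presented.

Definition cls (u : expr k X) : presented := \pi_presented u.

Lemma clsP u v : cls u = cls v <-> cong R u v.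
Proof.
split; first by move/eqmodP => /asboolP.
by move=> h; apply/eqmodP/asboolP.
Qed.

Lemma repr_cong u : cong R (repr (cls u)) u.
Proof. by apply/clsP; rewrite /cls reprK. Qed.

Lemma cls_ind (P : presented -> Prop) :
  (forall u, P (cls u)) -> forall x, P x.
Proof. by move=> h x; rewrite -[x]reprK; apply: h. Qed.

Definition padd (x y : presented) := cls (Add (repr x) (repr y)).
Definition pmul (x y : presented) := cls (Mul (repr x) (repr y)).
Definition popp (x : presented) := cls (Mul (Const (- 1)) (repr x)).

Lemma paddE u v : padd (cls u) (cls v) = cls (Add u v).
Proof. by apply/clsP; apply: cong_Add; apply: repr_cong. Qed.
Lemma pmulE u v : pmul (cls u) (cls v) = cls (Mul u v).
Proof. by apply/clsP; apply: cong_Mul; apply: repr_cong. Qed.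
Lemma poppE u : popp (cls u) = cls (Mul (Const (- 1)) u).
Proof.
by apply/clsP; apply: cong_Mul; [exact: cong_refl | exact: repr_cong].
Qed.

Let pE := (paddE, pmulE, poppE).

Lemma paddA : associative padd.
Proof.
elim/cls_ind=> u; elim/cls_ind=> v; elim/cls_ind=> w.
by rewrite !pE; apply/clsP; constructor.
Qed.
Lemma paddC : commutative padd.
Proof.
by elim/cls_ind=> u; elim/cls_ind=> v; rewrite !pE; apply/clsP; constructor.
Qed.
Lemma padd0 : left_id (cls (Const 0)) padd.
Proof. by elim/cls_ind=> u; rewrite !pE; apply/clsP; constructor. Qed.
Lemma paddN : left_inverse (cls (Const 0)) popp padd.
Proof.
elim/cls_ind=> u; rewrite !pE; apply/clsP.
apply: cong_trans (cong_mul0 _ u).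
apply: cong_trans
  (cong_Add (cong_refl _ _) (cong_sym (cong_mul1l _ u))) _.
apply: cong_trans (cong_sym (cong_mulDl _ _ _ _)) _.
apply: cong_Mul; last exact: cong_refl.
by have := cong_constD R (- 1) 1; rewrite addNr.
Qed.
HB.instance Definition _ :=
  GRing.isZmodule.Build presented paddA paddC padd0 paddN.

Lemma pmulA : associative pmul.
Proof.
elim/cls_ind=> u; elim/cls_ind=> v; elim/cls_ind=> w.
by rewrite !pE; apply/clsP; constructor.
Qed.
Lemma pmul1l : left_id (cls (Const 1)) pmul.
Proof. by elim/cls_ind=> u; rewrite !pE; apply/clsP; constructor. Qed.
Lemma pmul1r : right_id (cls (Const 1)) pmul.
Proof.
elim/cls_ind=> u; rewrite !pE; apply/clsP.
apply: cong_trans (cong_sym (cong_constC _ _ _)) _; exact: cong_mul1l.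
Qed.
Lemma pmulDl : left_distributive pmul padd.
Proof.
elim/cls_ind=> u; elim/cls_ind=> v; elim/cls_ind=> w.
by rewrite !pE; apply/clsP; constructor.
Qed.
Lemma pmulDr : right_distributive pmul padd.
Proof.
elim/cls_ind=> u; elim/cls_ind=> v; elim/cls_ind=> w.
by rewrite !pE; apply/clsP; constructor.
Qed.
HB.instance Definition _ := GRing.Zmodule_isPzRing.Build presented
  pmulA pmul1l pmul1r pmulDl pmulDr.

Definition pconst (c : k) : presented := cls (Const c).
Lemma pconstD c d : pconst (c + d) = pconst c + pconst d.
Proof.
by rewrite [RHS]paddE; apply/clsP; apply: cong_sym; exact: cong_constD.
Qed.
Lemma pconstM c d : pconst (c * d) = pconst c * pconst d.
Proof.
by rewrite [RHS]pmulE; apply/clsP; apply: cong_sym; exact: cong_constM.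
Qed.
Lemma pconstC c x : pconst c * x = x * pconst c.
Proof.
elim/cls_ind: x => u; rewrite [LHS]pmulE [RHS]pmulE; apply/clsP.
exact: cong_constC.
Qed.
HB.instance Definition _ := PzRing_isAlgebra.Build k presented
  pconstD pconstM erefl pconstC.

Definition gen (x : X) : presented := cls (Gen x).

Lemma clsD u v : cls (Add u v) = cls u + cls v.
Proof. exact/esym/paddE. Qed.
Lemma clsM u v : cls (Mul u v) = cls u * cls v.
Proof. exact/esym/pmulE. Qed.
Lemma clsE u : cls u = eval false idfun gen u.
Proof.
by elim: u => // u IHu v IHv /=; rewrite ?clsD ?clsM IHu IHv.
Qed.

Lemma gen_satisfies : satisfies false idfun gen R.
Proof. by move=> [u v] uvR /=; rewrite -!clsE; apply/clsP/cong_rel. Qed.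

Lemma presented_ind (P : presented -> Prop) :
  (forall c, P (emb c)) -> (forall x, P (gen x)) ->
  (forall x y, P x -> P y -> P (x + y)) ->
  (forall x y, P x -> P y -> P (x * y)) -> forall x, P x.
Proof.
move=> hC hG hD hM; elim/cls_ind.
elim=> // u IHu v IHv; rewrite ?clsD ?clsM; [exact: hD | exact: hM].
Qed.

(* The universal property: an assignment of the generators compatible with the
   relations extends to a [sigma]-semilinear map which is multiplicative, or
   antimultiplicative if [anti] holds. (The value of [extend] is independent of
   the choice of representatives only for compatible assignments.) *)
Section Extend.
Variables (A : algebraType k) (anti : bool) (sigma : {rmorphism k -> k}).
Variable f : X -> A.

Definition extend (x : presented) : A := eval anti sigma f (repr x).

Hypothesis Hf : satisfies anti sigma f R.

Lemma extend_cls u : extend (cls u) = eval anti sigma f u.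
Proof. exact: eval_cong Hf (repr_cong u). Qed.
Lemma extend_gen x : extend (gen x) = f x.
Proof. exact: extend_cls. Qed.
Lemma extend_emb c : extend (emb c) = emb (sigma c).
Proof. exact: extend_cls. Qed.
Lemma extendD x y : extend (x + y) = extend x + extend y.
Proof.
by elim/cls_ind: x => u; elim/cls_ind: y => v; rewrite -clsD !extend_cls.
Qed.
Lemma extendM x y :
  extend (x * y) = if anti then extend y * extend x else extend x * extend y.
Proof.
by elim/cls_ind: x => u; elim/cls_ind: y => v; rewrite -clsM !extend_cls.
Qed.
Lemma extend1 : extend 1 = 1.
Proof. by rewrite -(@emb1 k) extend_emb rmorph1 emb1. Qed.
Lemma extend_semilinear : semilinear_map sigma extend.
Proof.
split=> [|c x]; first exact: extendD.
by rewrite /scale extendM extend_emb; case: anti; rewrite // embC.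
Qed.
End Extend.

End Presented.
Arguments extend {k X R A} anti sigma f x.

Lemma satisfies_nil (k : comPzRingType) (X : Type) (A : algebraType k) anti
    (sigma : {rmorphism k -> k}) (f : X -> A) : satisfies anti sigma f [::].
Proof. by []. Qed.

Lemma satisfies_cons (k : comPzRingType) (X : Type) (A : algebraType k) anti
    (sigma : {rmorphism k -> k}) (f : X -> A) r R :
  satisfies anti sigma f (r :: R) <->
  eval anti sigma f r.1 = eval anti sigma f r.2 /\ satisfies anti sigma f R.
Proof.
split=> [h | [h hR] s].
  by split=> [|s sR]; apply: h; rewrite inE ?eqxx ?sR ?orbT.
by rewrite inE => /predU1P[-> | /hR].
Qed.

Lemma satisfiesE (k : comPzRingType) (X : Type) (A : algebraType k) anti
    (sigma : {rmorphism k -> k}) (f : X -> A) R :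
  satisfies anti sigma f R <->
  foldr (fun r Q => eval anti sigma f r.1 = eval anti sigma f r.2 /\ Q) True R.
Proof.
elim: R => [|r R IH] /=; first by split.
by split=> [/satisfies_cons[h /IH] | [h /IH hR]] //; apply/satisfies_cons.
Qed.

Lemma satisfies_cat (k : comPzRingType) (X : Type) (A : algebraType k) anti
    (sigma : {rmorphism k -> k}) (f : X -> A) R1 R2 :
  satisfies anti sigma f (R1 ++ R2) <->
  satisfies anti sigma f R1 /\ satisfies anti sigma f R2.
Proof.
split=> [h | [h1 h2] s]; last by rewrite mem_cat => /orP[/h1 | /h2].
by split=> s sR; apply: h; rewrite mem_cat sR ?orbT.
Qed.

(* The tensor product of two algebras over [k]: finite formal sums of pairs
   modulo the relations of a tensor product of [k]-modules. *)
Section Tensor.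
Variables (k : comPzRingType) (A B : algebraType k).

Inductive tcong : seq (A * B) -> seq (A * B) -> Prop :=
| tcong_refl s : tcong s s
| tcong_sym s t : tcong s t -> tcong t s
| tcong_trans s t u : tcong s t -> tcong t u -> tcong s u
| tcong_cat s s' t t' : tcong s s' -> tcong t t' -> tcong (s ++ t) (s' ++ t')
| tcong_catC s t : tcong (s ++ t) (t ++ s)
| tcong_addl a a' b : tcong [:: (a + a', b)] [:: (a, b); (a', b)]
| tcong_addr a b b' : tcong [:: (a, b + b')] [:: (a, b); (a, b')]
| tcong_scale c a b : tcong [:: (c *' a, b)] [:: (a, c *' b)]
| tcong_0l b : tcong [:: (0, b)] [::].

Definition tcongb (s t : seq (A * B)) : bool := `[< tcong s t >].

Lemma tcongb_refl : reflexive tcongb.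
Proof. by move=> u; apply/asboolP; exact: tcong_refl. Qed.
Lemma tcongb_sym : symmetric tcongb.
Proof. by move=> u v; apply/asboolP/asboolP => /tcong_sym. Qed.
Lemma tcongb_trans : transitive tcongb.
Proof.
move=> v u w /asboolP uv /asboolP vw; apply/asboolP.
exact: tcong_trans uv vw.
Qed.
Canonical tcongb_equiv := EquivRel tcongb tcongb_refl tcongb_sym tcongb_trans.

Definition tensor := {eq_quot tcongb_equiv}.
HB.instance Definition _ := Choice.on tensor.

Definition tcls (s : seq (A * B)) : tensor := \pi_tensor s.
Definition pure (a : A) (b : B) : tensor := tcls [:: (a, b)].

Lemma tclsP s t : tcls s = tcls t <-> tcong s t.
Proof.
split; first by move/eqmodP => /asboolP.
by move=> h; apply/eqmodP/asboolP.
Qed.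
Lemma trepr_cong s : tcong (repr (tcls s)) s.
Proof. by apply/tclsP; rewrite /tcls reprK. Qed.
Lemma tcls_ind (P : tensor -> Prop) :
  (forall s, P (tcls s)) -> forall x, P x.
Proof. by move=> h x; rewrite -[x]reprK; apply: h. Qed.

Definition tadd (x y : tensor) := tcls (repr x ++ repr y).
Definition topp (x : tensor) := tcls [seq (- p.1, p.2) | p <- repr x].

Lemma taddE s t : tadd (tcls s) (tcls t) = tcls (s ++ t).
Proof. by apply/tclsP; apply: tcong_cat; apply: trepr_cong. Qed.

Lemma taddA : associative tadd.
Proof.
elim/tcls_ind=> u; elim/tcls_ind=> v; elim/tcls_ind=> w.
by rewrite !taddE catA.
Qed.
Lemma taddC : commutative tadd.
Proof.
elim/tcls_ind=> u; elim/tcls_ind=> v; rewrite !taddE; apply/tclsP.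
exact: tcong_catC.
Qed.
Lemma tadd0 : left_id (tcls [::]) tadd.
Proof. by elim/tcls_ind=> u; rewrite taddE. Qed.
Lemma taddN : left_inverse (tcls [::]) topp tadd.
Proof.
move=> x; have -> : tadd (topp x) x = tadd (topp x) (tcls (repr x)).
  by rewrite [tcls _]reprK.
rewrite /topp; elim: (repr x) => [|[a b] s IHs] /=; first by rewrite taddE.
have cons2 p t : tcls (p :: t) = tadd (tcls [:: p]) (tcls t) by rewrite taddE.
rewrite cons2 [X in tadd _ X]cons2 -taddA [X in tadd _ X]taddA.
rewrite [X in tadd _ (tadd X _)]taddC -[X in tadd _ X]taddA IHs.
rewrite [X in tadd _ X]taddC tadd0 taddE; apply/tclsP.
apply: tcong_trans (tcong_sym (tcong_addl _ _ _)) _.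
by rewrite addNr; exact: tcong_0l.
Qed.
HB.instance Definition _ :=
  GRing.isZmodule.Build tensor taddA taddC tadd0 taddN.

Lemma tclsD s t : tcls (s ++ t) = tcls s + tcls t.
Proof. exact/esym/taddE. Qed.
Lemma pureDl a a' b : pure (a + a') b = pure a b + pure a' b.
Proof. by rewrite -tclsD; apply/tclsP; exact: tcong_addl. Qed.
Lemma pureDr a b b' : pure a (b + b') = pure a b + pure a b'.
Proof. by rewrite -tclsD; apply/tclsP; exact: tcong_addr. Qed.
Lemma pureZ c a b : pure (c *' a) b = pure a (c *' b).
Proof. by apply/tclsP; exact: tcong_scale. Qed.

Lemma tensor_ind (P : tensor -> Prop) :
  P 0 -> (forall a b, P (pure a b)) ->
  (forall x y, P x -> P y -> P (x + y)) -> forall x, P x.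
Proof.
move=> h0 hp hD; elim/tcls_ind; elim=> [//|[a b] s IHs].
by rewrite -cat1s tclsD; apply: hD => //; apply: hp.
Qed.

Section TensorLift.
Variables (V : zmodType) (f : A -> B -> V).

Definition tensor_lift (x : tensor) : V := \sum_(p <- repr x) f p.1 p.2.

Definition balanced : Prop :=
  [/\ forall a a' b, f (a + a') b = f a b + f a' b,
      forall a b b', f a (b + b') = f a b + f a b' &
      forall c a b, f (c *' a) b = f a (c *' b)].
Hypothesis Hf : balanced.

Lemma tensor_lift_cls s : tensor_lift (tcls s) = \sum_(p <- s) f p.1 p.2.
Proof.
have [hl hr hc] := Hf; rewrite /tensor_lift.
move: (repr _) (trepr_cong s) => t; elim=> {s t}.
- by [].
- by move=> s t _ ->.
- by move=> s t u _ -> _ ->.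
- by move=> s s' t t' _ h _ h'; rewrite !big_cat /= h h'.
- by move=> s t; rewrite !big_cat /= addrC.
- by move=> a a' b; rewrite !big_cons !big_nil !addr0 hl.
- by move=> a b b'; rewrite !big_cons !big_nil !addr0 hr.
- by move=> c a b; rewrite !big_cons !big_nil !addr0 hc.
- move=> b; rewrite !big_cons !big_nil !addr0 /=.
  by apply: (addIr (f 0 b)); rewrite -hl !add0r.
Qed.
Lemma tensor_lift_pure a b : tensor_lift (pure a b) = f a b.
Proof. by rewrite tensor_lift_cls big_cons big_nil addr0. Qed.
Lemma tensor_liftD x y : tensor_lift (x + y) = tensor_lift x + tensor_lift y.
Proof.
elim/tcls_ind: x => s; elim/tcls_ind: y => t.
by rewrite -tclsD !tensor_lift_cls big_cat.
Qed.
Lemma tensor_lift0 : tensor_lift 0 = 0.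
Proof. by apply: (addIr (tensor_lift 0)); rewrite -tensor_liftD !add0r. Qed.
End TensorLift.

(* Multiplication: [pure a b * pure a' b' = pure (a * a') (b * b')]. *)
Definition tlmul (a : A) (b : B) : tensor -> tensor :=
  tensor_lift (fun a' b' => pure (a * a') (b * b')).
Definition tmul (x y : tensor) : tensor :=
  tensor_lift (fun a b => tlmul a b y) x.

Lemma tlmul_balanced a b : balanced (fun a' b' => pure (a * a') (b * b')).
Proof.
split=> [a' a'' b'|a' b' b''|c a' b'].
- by rewrite mulrDr pureDl.
- by rewrite mulrDr pureDr.
- rewrite /scale !mulrA -!embC -!mulrA -!/(scale _ _) pureZ.
  by rewrite /scale !mulrA.
Qed.
Lemma tlmul_pure a b a' b' :
  tlmul a b (pure a' b') = pure (a * a') (b * b').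
Proof. exact: tensor_lift_pure (tlmul_balanced a b) _ _. Qed.
Lemma tlmulD a b x y : tlmul a b (x + y) = tlmul a b x + tlmul a b y.
Proof. exact: tensor_liftD (tlmul_balanced a b) _ _. Qed.
Lemma tlmul0 a b : tlmul a b 0 = 0.
Proof. exact: tensor_lift0 (tlmul_balanced a b). Qed.

Lemma tmul_balanced y : balanced (fun a b => tlmul a b y).
Proof.
split=> [a a' b|a b b'|c a b]; elim/tensor_ind: y => [|a0 b0|x y hx hy].
- by rewrite !tlmul0 addr0.
- by rewrite !tlmul_pure mulrDl pureDl.
- by rewrite !tlmulD hx hy addrACA.
- by rewrite !tlmul0 addr0.
- by rewrite !tlmul_pure mulrDl pureDr.
- by rewrite !tlmulD hx hy addrACA.
- by rewrite !tlmul0.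
- by rewrite !tlmul_pure /scale -!mulrA -!/(scale _ _) pureZ.
- by rewrite !tlmulD hx hy.
Qed.
Lemma tmul_pure a b y : tmul (pure a b) y = tlmul a b y.
Proof. exact: tensor_lift_pure (tmul_balanced y) _ _. Qed.
Lemma tmulDl : left_distributive tmul +%R.
Proof. by move=> x y z; exact: tensor_liftD (tmul_balanced z) _ _. Qed.
Lemma tmul0 y : tmul 0 y = 0.
Proof. exact: tensor_lift0 (tmul_balanced y). Qed.
Lemma tmulDr : right_distributive tmul +%R.
Proof.
move=> x y z; elim/tensor_ind: x => [|a b|x x' hx hx'].
- by rewrite !tmul0 addr0.
- by rewrite !tmul_pure tlmulD.
- by rewrite !tmulDl hx hx' addrACA.
Qed.
Lemma tmulr0 x : tmul x 0 = 0.
Proof. by apply: (addIr (tmul x 0)); rewrite -tmulDr !add0r. Qed.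
Lemma tmulA : associative tmul.
Proof.
move=> x y z; elim/tensor_ind: x => [|a b|x x' hx hx'].
- by rewrite !tmul0.
- elim/tensor_ind: y => [|a' b'|y y' hy hy'].
  + by rewrite tmul0 tmulr0 tmul0.
  + elim/tensor_ind: z => [|a'' b''|z z' hz hz'].
    * by rewrite !tmulr0.
    * by rewrite !(tmul_pure, tlmul_pure) !mulrA.
    * by rewrite !tmulDr hz hz'.
  + by rewrite !(tmulDr, tmulDl) hy hy'.
- by rewrite !tmulDl hx hx'.
Qed.
Lemma tmul1l : left_id (pure 1 1) tmul.
Proof.
elim/tensor_ind=> [|a b|x y hx hy]; first exact: tmulr0.
- by rewrite tmul_pure tlmul_pure !mul1r.
- by rewrite tmulDr hx hy.
Qed.
Lemma tmul1r : right_id (pure 1 1) tmul.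
Proof.
elim/tensor_ind=> [|a b|x y hx hy]; first exact: tmul0.
- by rewrite tmul_pure tlmul_pure !mulr1.
- by rewrite tmulDl hx hy.
Qed.
HB.instance Definition _ := GRing.Zmodule_isPzRing.Build tensor
  tmulA tmul1l tmul1r tmulDl tmulDr.

Lemma pureM a b a' b' : pure a b * pure a' b' = pure (a * a') (b * b').
Proof. by rewrite [LHS]tmul_pure tlmul_pure. Qed.
Lemma pure1 : pure 1 1 = 1.
Proof. by []. Qed.

Definition tscalar (c : k) : tensor := pure (emb c) 1.
Lemma tscalarD c d : tscalar (c + d) = tscalar c + tscalar d.
Proof. by rewrite /tscalar embD pureDl. Qed.
Lemma tscalarM c d : tscalar (c * d) = tscalar c * tscalar d.
Proof. by rewrite pureM /tscalar embM mulr1. Qed.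
Lemma tscalar1 : tscalar 1 = 1.
Proof. by rewrite /tscalar emb1. Qed.
Lemma tscalarC c x : tscalar c * x = x * tscalar c.
Proof.
elim/tensor_ind: x => [|a b|x y hx hy]; first by rewrite mul0r mulr0.
- by rewrite !pureM embC mulr1 mul1r.
- by rewrite mulrDl mulrDr hx hy.
Qed.
HB.instance Definition _ := PzRing_isAlgebra.Build k tensor
  tscalarD tscalarM tscalar1 tscalarC.

Lemma pureZl c a b : pure (c *' a) b = c *' pure a b.
Proof. by rewrite [RHS]pureM mul1r. Qed.

End Tensor.
Arguments pure {k A B}.

(* The tensor product [f (x) g] of two [sigma]-semilinear maps. *)
Section TensorMap.
Variables (k : comPzRingType) (A A' B B' : algebraType k).
Variables (f : A -> A') (g : B -> B').

Definition tensor_map : tensor A B -> tensor A' B' :=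
  tensor_lift (fun a b => pure (f a) (g b)).

Variable sigma : k -> k.
Hypotheses (Hf : semilinear_map sigma f) (Hg : semilinear_map sigma g).

Lemma tensor_map_balanced : balanced (fun a b => pure (f a) (g b)).
Proof.
have [[fD fZ] [gD gZ]] := (Hf, Hg).
split=> [a a' b|a b b'|c a b].
- by rewrite fD pureDl.
- by rewrite gD pureDr.
- by rewrite fZ gZ pureZ.
Qed.
Lemma tensor_map_pure a b : tensor_map (pure a b) = pure (f a) (g b).
Proof. exact: tensor_lift_pure tensor_map_balanced _ _. Qed.
Lemma tensor_mapD x y : tensor_map (x + y) = tensor_map x + tensor_map y.
Proof. exact: tensor_liftD tensor_map_balanced _ _. Qed.
End TensorMap.

Lemma algebra_hom_emb (k : comPzRingType) (A B : algebraType k)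
    (f : A -> B) c : algebra_hom f -> f (emb c) = emb c.
Proof.
by case=> -[_ fZ] _ f1; have := fZ c 1; rewrite /scale f1 !mulr1.
Qed.

Lemma satisfies_hom (k : comPzRingType) (X : Type) (A B : algebraType k)
    (phi : A -> B) (f : X -> A) (R : relations k X) :
  algebra_hom phi -> satisfies false idfun f R ->
  satisfies false idfun (phi \o f) R.
Proof.
move=> hphi hf r /hf; have [[phiD _] phiM _] := hphi.
have E u : eval false idfun (phi \o f) u = phi (eval false idfun f u).
  elim: u => [c|x|u IHu v IHv|u IHu v IHv] //=.
  - by rewrite algebra_hom_emb.
  - by rewrite IHu IHv phiD.
  - by rewrite IHu IHv phiM.
by rewrite !E => ->.
Qed.

(* A decision procedure, by rewriting to normal form, for identities between
   noncommutative polynomials whose coefficients are polynomials in the two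
   invertible scalars [q], [l] and their inverses. *)
Section Checker.

Inductive rterm : Type :=
| RLetter of nat | RQ | RQV | RL | RLV | ROne
| RAdd of rterm & rterm | RMul of rterm & rterm | ROpp of rterm.

Definition exps := (nat * nat * nat * nat)%type.
Definition mono := (int * exps * seq nat)%type.

Definition exps_norm (e : exps) : exps :=
  let: (a, b, c, d) := e in ((a - b)%N, (b - a)%N, (c - d)%N, (d - c)%N).
Definition exps_add (e f : exps) : exps :=
  let: (a, b, c, d) := e in let: (a', b', c', d') := f in
  exps_norm ((a + a')%N, (b + b')%N, (c + c')%N, (d + d')%N).
Definition mono_mul (m n : mono) : mono :=
  let: (c, e, w) := m in let: (c', e', w') := n in
  (c * c', exps_add e e', w ++ w').

Fixpoint poly_of (t : rterm) : seq mono :=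
  match t with
  | RLetter n => [:: (1, (0, 0, 0, 0)%N, [:: n])]
  | RQ => [:: (1, (1, 0, 0, 0)%N, [::])]
  | RQV => [:: (1, (0, 1, 0, 0)%N, [::])]
  | RL => [:: (1, (0, 0, 1, 0)%N, [::])]
  | RLV => [:: (1, (0, 0, 0, 1)%N, [::])]
  | ROne => [:: (1, (0, 0, 0, 0)%N, [::])]
  | RAdd u v => poly_of u ++ poly_of v
  | RMul u v => [seq mono_mul m n | m <- poly_of u, n <- poly_of v]
  | ROpp u => [seq (- m.1.1, m.1.2, m.2) | m <- poly_of u]
  end.

Definition rules := seq (nat * nat * rterm).

Fixpoint find_rule (R : rules) (x y : nat) : option (seq mono) :=
  match R with
  | [::] => None
  | (x', y', t) :: R' =>
    if (x == x') && (y == y') then Some (poly_of t) else find_rule R' x y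
  end.

Fixpoint step (R : rules) (w : seq nat) : option (seq mono) :=
  match w with
  | x :: w' =>
    match w' with
    | y :: w'' =>
      match find_rule R x y with
      | Some p => Some [seq (m.1, m.2 ++ w'') | m <- p]
      | None =>
        match step R w' with
        | Some p => Some [seq (m.1, x :: m.2) | m <- p]
        | None => None
        end
      end
    | [::] => None
    end
  | [::] => None
  end.

Fixpoint nf (R : rules) (fuel : nat) (m : mono) : seq mono :=
  match fuel with
  | 0%N => [:: m]
  | n.+1 =>
    match step R m.2 with
    | Some p => flatten [seq nf R n (mono_mul (m.1, [::]) m') | m' <- p]
    | None => [:: m]
    end
  end.

Fixpoint collect (m : mono) (p : seq mono) : seq mono :=
  match p with
  | [::] => [:: m]
  | n :: p' =>
    if (m.1.2 == n.1.2) && (m.2 == n.2) then (m.1.1 + n.1.1, n.1.2, n.2) :: p'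
    else n :: collect m p'
  end.

Definition check (R : rules) (fuel : nat) (t : rterm) : bool :=
  all (fun m : mono => m.1.1 == 0)
    (foldr collect [::] (flatten [seq nf R fuel m | m <- poly_of t])).

Variables (k : comPzRingType) (A : algebraType k) (q qV l lV : k).
Hypotheses (qqV : q * qV = 1) (llV : l * lV = 1).
Variable env : nat -> A.

Fixpoint reval (t : rterm) : A :=
  match t with
  | RLetter n => env n
  | RQ => emb q
  | RQV => emb qV
  | RL => emb l
  | RLV => emb lV
  | ROne => 1
  | RAdd u v => reval u + reval v
  | RMul u v => reval u * reval v
  | ROpp u => - reval u
  end.

Fixpoint rules_sound (R : rules) : Prop :=
  match R with
  | [::] => True
  | (x, y, t) :: R' => env x * env y = reval t /\ rules_sound R'
  end.

Lemma rules_sound_cat R1 R2 :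
  rules_sound R1 -> rules_sound R2 -> rules_sound (R1 ++ R2).
Proof. by elim: R1 => [//|[[x y] t] R1 IH] /= [h1 h2] h3; split; auto. Qed.

Definition exps_val (e : exps) : k :=
  let: (a, b, c, d) := e in q ^+ a * qV ^+ b * (l ^+ c * lV ^+ d).
Definition word_val (w : seq nat) : A := \prod_(n <- w) env n.
Definition mono_val (m : mono) : A :=
  (emb (exps_val m.1.2) * word_val m.2) *~ m.1.1.
Definition poly_val (p : seq mono) : A := \sum_(m <- p) mono_val m.

Lemma cancel_exp (x y : k) a b :
  x * y = 1 -> x ^+ (a - b)%N * y ^+ (b - a)%N = x ^+ a * y ^+ b.
Proof.
move=> xy; elim: a b => [|a IH] [|b]; rewrite ?sub0n ?subn0 ?subSS //.
by rewrite IH exprSr exprS mulrA -[_ * x * y]mulrA xy mulr1.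
Qed.

Lemma exps_val_norm e : exps_val (exps_norm e) = exps_val e.
Proof. by case: e => [[[a b] c] d] /=; rewrite !cancel_exp. Qed.

Lemma exps_val_add e f :
  exps_val (exps_add e f) = exps_val e * exps_val f.
Proof.
case: e => [[[a b] c] d]; case: f => [[[a' b'] c'] d'].
rewrite exps_val_norm /= !exprD.
by rewrite [RHS]mulrACA; congr (_ * _); apply: mulrACA.
Qed.

Lemma mono_val_mul m n : mono_val (mono_mul m n) = mono_val m * mono_val n.
Proof.
case: m => [[c e] w]; case: n => [[c' e'] w'] /=; rewrite /mono_val /=.
rewrite exps_val_add embM /word_val big_cat /= mulrzAl mulrzAr -mulrzA.
rewrite mulrC; congr (_ *~ _).
rewrite -!mulrA; congr (_ * _).
by rewrite !mulrA embC.
Qed.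

Lemma poly_of_val t : poly_val (poly_of t) = reval t.
Proof.
have E (x : k) : emb (x * 1 * (1 * 1)) * 1 = emb x :> A.
  by rewrite !mulr1.
elim: t => [n||||||u IHu v IHv|u IHu v IHv|u IHu] /=.
- by rewrite /poly_val big_seq1 /mono_val /= /word_val big_seq1 !mulr1 emb1
    mul1r mulr1z.
- by rewrite /poly_val big_seq1 /mono_val /= /word_val big_nil !mulr1 mulr1z.
- by rewrite /poly_val big_seq1 /mono_val /= /word_val big_nil !(mulr1, mul1r)
    mulr1z.
- by rewrite /poly_val big_seq1 /mono_val /= /word_val big_nil !(mulr1, mul1r)
    mulr1z.
- by rewrite /poly_val big_seq1 /mono_val /= /word_val big_nil !(mulr1, mul1r)
    mulr1z.
- by rewrite /poly_val big_seq1 /mono_val /= /word_val big_nil !(mulr1, mul1r)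
    mulr1z emb1.
- by rewrite /poly_val big_cat /= -/(poly_val _) -/(poly_val _) IHu IHv.
- rewrite -IHu -IHv /poly_val big_allpairs_dep /= mulr_suml.
  apply: eq_bigr => m _; rewrite mulr_sumr; apply: eq_bigr => n _.
  exact: mono_val_mul.
- rewrite -IHu /poly_val big_map -sumrN; apply: eq_bigr => m _.
  by rewrite /mono_val /= mulrNz.
Qed.

Lemma find_rule_val R x y p :
  rules_sound R -> find_rule R x y = Some p -> env x * env y = poly_val p.
Proof.
elim: R => [//|[[x' y'] t] R IH] /= [h hR].
case: andP => [[/eqP -> /eqP ->] [<-]|_]; last exact: IH.
by rewrite poly_of_val.
Qed.

Lemma word_val_cons x w : word_val (x :: w) = env x * word_val w.
Proof. exact: big_cons. Qed.

Lemma step_val R w p :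
  rules_sound R -> step R w = Some p -> word_val w = poly_val p.
Proof.
move=> hR; elim: w p => [//|x [//|y w] IH] p.
rewrite [step _ _]/=; case E: (find_rule R x y) => [p'|].
  case=> <-; rewrite !word_val_cons mulrA (find_rule_val hR E).
  rewrite /poly_val mulr_suml big_map; apply: eq_bigr => m _.
  by rewrite /mono_val /= /word_val big_cat /= mulrzAl !mulrA.
rewrite -/(step R (y :: w)); case E': (step R (y :: w)) => [p'|//] [<-].
rewrite word_val_cons (IH _ E') /poly_val mulr_sumr big_map.
apply: eq_bigr => m _.
by rewrite /mono_val /= word_val_cons mulrzAr !mulrA embC.
Qed.

Lemma nf_val R n m : rules_sound R -> poly_val (nf R n m) = mono_val m.
Proof.
move=> hR; elim: n m => [|n IH] m /=; first by rewrite /poly_val big_seq1.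
case E: (step R m.2) => [p|]; last by rewrite /poly_val big_seq1.
have -> : mono_val m = mono_val (m.1, [::]) * poly_val p.
  rewrite -(step_val hR E) /mono_val /= /word_val big_nil mulr1.
  by rewrite mulrzAl.
rewrite /poly_val big_flatten /= big_map mulr_sumr; apply: eq_bigr => m' _.
by rewrite -mono_val_mul -IH.
Qed.

Lemma collect_val m p : poly_val (collect m p) = mono_val m + poly_val p.
Proof.
elim: p => [|n p IH] /=; first by rewrite /poly_val big_seq1 big_nil addr0.
case: andP => [[/eqP h1 /eqP h2]|_]; rewrite /poly_val !big_cons -/(poly_val _).
  by rewrite addrA; congr (_ + _); rewrite /mono_val /= h1 h2 mulrzDr.
by rewrite IH addrCA.
Qed.

Lemma check_val R n t : rules_sound R -> check R n t -> reval t = 0.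
Proof.
move=> hR; rewrite /check -poly_of_val.
have -> : poly_val (poly_of t) =
    poly_val (foldr collect [::] (flatten [seq nf R n m | m <- poly_of t])).
  have -> s : poly_val (foldr collect [::] s) = poly_val s.
    elim: s => //= m s IH.
    by rewrite collect_val IH /poly_val big_cons.
  rewrite /poly_val big_flatten /= big_map; apply: eq_bigr => m _.
  by rewrite -(nf_val n m hR).
elim: (foldr _ _ _) => [|m p IH] /=; first by rewrite /poly_val big_nil.
case/andP=> /eqP h /IH; rewrite /poly_val big_cons => ->.
by rewrite /mono_val h mulr0z addr0.
Qed.

Lemma check_eq R n t1 t2 :
  rules_sound R -> check R n (RAdd t1 (ROpp t2)) -> reval t1 = reval t2.
Proof. by move=> hR /(check_val hR) /eqP; rewrite subr_eq0 => /eqP. Qed.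

End Checker.

(* The ground ring with its conjugation and the parameters [q], [l], together
   with their inverses. *)
Record parameters := MkParameters {
  ground : comPzRingType;
  par_conj : {rmorphism ground -> ground};
  par_q : ground;
  par_qV : ground;
  par_l : ground;
  par_lV : ground;
  conjK : involutive par_conj;
  par_qqV : par_q * par_qV = 1;
  par_llV : par_l * par_lV = 1;
  conj_q : par_conj par_q = par_q;
  conj_l : par_conj par_l = par_l
}.
Arguments par_conj {p}.

Section ComplexParameters.
Variables (R : realType) (q0 l0 : R) (Hq : q0 != 0) (Hl : l0 != 0).

Lemma real_complex_mulV (x : R) : x != 0 -> (x%:C * (x^-1)%:C)%C = 1 :> R[i].
Proof. by move=> x0; rewrite -rmorphM /= divff. Qed.

Definition complex_parameters : parameters :=
  @MkParameters R[i] conjc q0%:C%C (q0^-1)%:C%C l0%:C%C (l0^-1)%:C%C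
    (@conjcK R) (real_complex_mulV Hq) (real_complex_mulV Hl)
    (conjc_real q0) (conjc_real l0).
End ComplexParameters.

(* The ring of Laurent polynomials in two indeterminates, and the extension of
   complex conjugation which fixes the indeterminates. *)
Section LaurentParameters.
Variable R : realType.

Inductive laurent_gen := LaurentQ | LaurentQV | LaurentL | LaurentLV.
HB.instance Definition _ := gen_eqMixin laurent_gen.

Definition laurent_rels : relations R[i] laurent_gen :=
  let gens := [:: LaurentQ; LaurentQV; LaurentL; LaurentLV] in
  [:: Gen LaurentQ * Gen LaurentQV === 1%R%:c;
      Gen LaurentL * Gen LaurentLV === 1%R%:c] ++
  [seq (Gen x * Gen y === Gen y * Gen x) | x <- gens, y <- gens].

Definition laurent := presented laurent_rels.
HB.instance Definition _ := AlgebraOver.on laurent.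

Let lgen (x : laurent_gen) : laurent := gen laurent_rels x.

Lemma lgenC x y : lgen x * lgen y = lgen y * lgen x.
Proof.
refine (gen_satisfies (R := laurent_rels)
  (r := (Gen x * Gen y === Gen y * Gen x)) _).
rewrite mem_cat; apply/orP; right; apply/allpairsP.
by exists (x, y); split=> //; [case: x | case: y]; rewrite !inE eqxx ?orbT.
Qed.

Lemma laurent_mulC : commutative (@GRing.mul laurent).
Proof.
move=> x y; elim/presented_ind: x => [c|a|x x' hx hx'|x x' hx hx'].
- by rewrite embC.
- elim/presented_ind: y => [c|b|y y' hy hy'|y y' hy hy'].
  + by rewrite embC.
  + exact: lgenC.
  + by rewrite mulrDl mulrDr hy hy'.
  + by rewrite mulrA hy -mulrA hy' mulrA.
- by rewrite mulrDl mulrDr hx hx'.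
- by rewrite -mulrA hx' mulrA hx mulrA.
Qed.
HB.instance Definition _ := GRing.PzRing_hasCommutativeMul.Build laurent
  laurent_mulC.

Lemma laurent_qqV : lgen LaurentQ * lgen LaurentQV = 1.
Proof.
rewrite -(@emb1 R[i]).
refine (gen_satisfies (R := laurent_rels)
  (r := (Gen LaurentQ * Gen LaurentQV === 1%R%:c)) _).
by rewrite !inE eqxx.
Qed.
Lemma laurent_llV : lgen LaurentL * lgen LaurentLV = 1.
Proof.
rewrite -(@emb1 R[i]).
refine (gen_satisfies (R := laurent_rels)
  (r := (Gen LaurentL * Gen LaurentLV === 1%R%:c)) _).
by rewrite !inE eqxx orbT.
Qed.

Lemma laurent_conj_rels :
  satisfies false (conjc : {rmorphism R[i] -> R[i]}) lgen laurent_rels.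
Proof.
have E : emb (conjc (1 : R[i])) = 1 :> laurent.
  by rewrite -(@emb1 R[i]); congr emb; apply: rmorph1.
apply/satisfies_cons; split.
  by rewrite [RHS]E; exact: laurent_qqV.
apply/satisfies_cons; split.
  by rewrite [RHS]E; exact: laurent_llV.
move=> r /allpairsP[[x y] [_ _ ->]] /=; exact: lgenC.
Qed.

Definition laurent_conj : laurent -> laurent := extend false conjc lgen.

Lemma laurent_conj_zmod : zmod_morphism laurent_conj.
Proof.
move=> x y; apply: (addIr (laurent_conj y)); rewrite /laurent_conj.
by rewrite -(extendD laurent_conj_rels) !subrK.
Qed.
HB.instance Definition _ := GRing.isZmodMorphism.Build laurent laurent
  laurent_conj laurent_conj_zmod.
Lemma laurent_conj_monoid : monoid_morphism laurent_conj.
Proof. by split=> [|x y]; [exact: extend1 laurent_conj_rels | exact: extendM laurent_conj_rels _ _]. Qed.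
HB.instance Definition _ := GRing.isMonoidMorphism.Build laurent laurent
  laurent_conj laurent_conj_monoid.

Lemma laurent_conjK : involutive laurent_conj.
Proof.
move=> x; elim/presented_ind: x => [c|a|x y hx hy|x y hx hy].
- rewrite /laurent_conj !(extend_emb laurent_conj_rels); congr emb.
  exact: conjcK.
- by rewrite /laurent_conj !(extend_gen laurent_conj_rels).
- by rewrite !rmorphD /= hx hy.
- by rewrite !rmorphM /= hx hy.
Qed.

Definition laurent_parameters : parameters :=
  @MkParameters laurent laurent_conj
    (lgen LaurentQ) (lgen LaurentQV) (lgen LaurentL) (lgen LaurentLV)
    laurent_conjK laurent_qqV laurent_llV
    (extend_gen laurent_conj_rels _) (extend_gen laurent_conj_rels _).
End LaurentParameters.

Definition mx2 (T : Type) (x11 x12 x21 x22 : T) (i j : 'I_2) : T :=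
  if i == ord0 then if j == ord0 then x11 else x12
  else if j == ord0 then x21 else x22.

Lemma forall_mx2 (P : 'I_2 -> 'I_2 -> Prop) :
  P ord0 ord0 -> P ord0 ord_max -> P ord_max ord0 -> P ord_max ord_max ->
  forall i j, P i j.
Proof.
have I2 (i : 'I_2) : i = ord0 \/ i = ord_max.
  by case: i => [[|[|//]] Hi]; [left | right]; apply: val_inj.
by move=> h1 h2 h3 h4 i j; case: (I2 i) => ->; case: (I2 j) => ->.
Qed.

(* The indices 1 and 2 are [ord0] and [ord_max]. *)
Section LinkedAlgebras.
Variable P : parameters.
Local Notation k := (ground P).
Local Notation q := (par_q P).
Local Notation qV := (par_qV P).
Local Notation l := (par_l P).
Local Notation lV := (par_lV P).

Section MinkowskiRelations.
Variables (X : Type) (t : 'I_2 -> 'I_2 -> expr k X).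
Let t11 := t ord0 ord0.
Let t12 := t ord0 ord_max.
Let t21 := t ord_max ord0.
Let t22 := t ord_max ord_max.
Definition minkowski_rels_of : relations k X :=
  [:: t11 * t12 === (q * l)%R%:c * (t12 * t11);
      t12 * t22 === (qV * l)%R%:c * (t22 * t12);
      t12 * t21 === t21 * t12 + (l * (qV - q))%R%:c * (t11 * t22);
      t11 * t22 === t22 * t11;
      t11 * t21 === (qV * lV)%R%:c * (t21 * t11);
      t21 * t22 === (q * lV)%R%:c * (t22 * t21)].
End MinkowskiRelations.

Definition minkowski_rels : relations k ('I_2 * 'I_2) :=
  minkowski_rels_of (fun i j => Gen (i, j)).

Definition minkowski := presented minkowski_rels.
HB.instance Definition _ := AlgebraOver.on minkowski.

Definition t_ (i j : 'I_2) : minkowski := gen minkowski_rels (i, j).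

Section SL2Relations.
Variables (X : Type) (a b c d : expr k X).
Definition sl2_rels : relations k X :=
  [:: a * b === qV%:c * (b * a);
      a * c === qV%:c * (c * a);
      b * d === qV%:c * (d * b);
      c * d === qV%:c * (d * c);
      a * d - d * a === (qV - q)%R%:c * (b * c);
      b * c === c * b;
      a * d - qV%:c * (b * c) === 1%R%:c].
End SL2Relations.

Section LinkRelations.
Variables (X : Type) (a b c d a' b' c' d' : expr k X).
Definition link_rels : relations k X :=
  [:: b' * a === l%:c * (a * b');
      a * c' === l%:c * (c' * a);
      a' * b === l%:c * (b * a');
      b * d' === l%:c * (d' * b);
      c * a' === l%:c * (a' * c);
      d' * c === l%:c * (c * d');
      d * b' === l%:c * (b' * d);
      c' * d === l%:c * (d * c');
      a * a' === a' * a;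
      a * d' === d' * a;
      b * b' === b' * b;
      b * c' === c' * b;
      c * b' === b' * c;
      c * c' === c' * c;
      d * a' === a' * d;
      d * d' === d' * d].
End LinkRelations.

(* The quantum group [G = SL_q(2) (+)^l SL_q(2)], generated by the entries of the
   two matrices [x] and [y]. *)
Inductive linked_gen := GenX of 'I_2 & 'I_2 | GenY of 'I_2 & 'I_2.

Definition linked_rels : relations k linked_gen :=
  let a := Gen (GenX ord0 ord0) in let b := Gen (GenX ord0 ord_max) in
  let c := Gen (GenX ord_max ord0) in let d := Gen (GenX ord_max ord_max) in
  let a' := Gen (GenY ord0 ord0) in let b' := Gen (GenY ord0 ord_max) in
  let c' := Gen (GenY ord_max ord0) in let d' := Gen (GenY ord_max ord_max) in
  sl2_rels a b c d ++ sl2_rels a' b' c' d' ++ link_rels a b c d a' b' c' d'.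

Definition linkedSL2 := presented linked_rels.
HB.instance Definition _ := AlgebraOver.on linkedSL2.

Definition x_ (i j : 'I_2) : linkedSL2 := gen linked_rels (GenX i j).
Definition y_ (i j : 'I_2) : linkedSL2 := gen linked_rels (GenY i j).

Definition antipode_gen (g : linked_gen) : linkedSL2 :=
  let adj m := mx2 (m ord_max ord_max) (- q *' m ord0 ord_max)
                   (- qV *' m ord_max ord0) (m ord0 ord0) in
  match g with GenX i j => adj x_ i j | GenY i j => adj y_ i j end.

Definition antipode : linkedSL2 -> linkedSL2 := extend true idfun antipode_gen.

(* With [star_l], [linkedSL2] is the quantum group [SO_q^l(3,1)]. *)
Definition star_l_gen (g : linked_gen) : linkedSL2 :=
  match g with
  | GenX i j => antipode (y_ j i)
  | GenY i j => antipode (x_ j i)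
  end.
Definition star_l : linkedSL2 -> linkedSL2 := extend true par_conj star_l_gen.

Definition star_m : minkowski -> minkowski :=
  extend true par_conj (fun g => t_ g.2 g.1).

Definition rho_gen (g : 'I_2 * 'I_2) : tensor linkedSL2 minkowski :=
  \sum_(s < 2) \sum_(r < 2) pure (y_ g.1 s * antipode (x_ r g.2)) (t_ s r).
Definition rho : minkowski -> tensor linkedSL2 minkowski :=
  extend false idfun rho_gen.

Lemma mulV_flip (A : algebraType k) (c cV : k) (u v : A) :
  c * cV = 1 -> u * v = emb cV * (v * u) -> v * u = emb c * (u * v).
Proof. by move=> h ->; rewrite mulrA -embM h emb1 mul1r. Qed.

Definition sl2_rules (a b c d : nat) : rules :=
  let A := RLetter a in let B := RLetter b in
  let C := RLetter c in let D := RLetter d in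
  [:: (a, b, RMul RQV (RMul B A)); (a, c, RMul RQV (RMul C A));
      (d, b, RMul RQ (RMul B D)); (d, c, RMul RQ (RMul C D));
      (c, b, RMul B C); (a, d, RAdd ROne (RMul RQV (RMul B C)));
      (d, a, RAdd ROne (RMul RQ (RMul B C)))].

Definition link_rules (a b c d a' b' c' d' : nat) : rules :=
  let L x := RLetter x in
  [:: (b', a, RMul RL (RMul (L a) (L b')));
      (c', a, RMul RLV (RMul (L a) (L c')));
      (a', b, RMul RL (RMul (L b) (L a')));
      (d', b, RMul RLV (RMul (L b) (L d')));
      (a', c, RMul RLV (RMul (L c) (L a')));
      (d', c, RMul RL (RMul (L c) (L d')));
      (b', d, RMul RLV (RMul (L d) (L b')));
      (c', d, RMul RL (RMul (L d) (L c')));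
      (a', a, RMul (L a) (L a')); (d', a, RMul (L a) (L d'));
      (b', b, RMul (L b) (L b')); (c', b, RMul (L b) (L c'));
      (b', c, RMul (L c) (L b')); (c', c, RMul (L c) (L c'));
      (a', d, RMul (L d) (L a')); (d', d, RMul (L d) (L d'))].

Definition minkowski_rules (t11 t12 t21 t22 : nat) : rules :=
  let L x := RLetter x in
  [:: (t12, t21, RAdd (RMul (L t21) (L t12))
         (RMul (RMul RL (RAdd RQV (ROpp RQ))) (RMul (L t11) (L t22))));
      (t11, t21, RMul (RMul RQV RLV) (RMul (L t21) (L t11)));
      (t22, t21, RMul (RMul RQV RL) (RMul (L t21) (L t22)));
      (t12, t11, RMul (RMul RQV RLV) (RMul (L t11) (L t12)));
      (t12, t22, RMul (RMul RQV RL) (RMul (L t22) (L t12)));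
      (t22, t11, RMul (L t11) (L t22))].

Definition linked_rules : rules :=
  sl2_rules 0 1 2 3 ++ sl2_rules 4 5 6 7 ++ link_rules 0 1 2 3 4 5 6 7.

Section Soundness.
Variables (A : algebraType k) (env : nat -> A).
Local Notation sound := (rules_sound q qV l lV env).
Let qV_q : qV * q = 1. Proof. by rewrite mulrC par_qqV. Qed.
Let lV_l : lV * l = 1. Proof. by rewrite mulrC par_llV. Qed.

Lemma sl2_sound (X : Type) (f : X -> A) (a b c d : X) (na nb nc nd : nat) :
  f a = env na -> f b = env nb -> f c = env nc -> f d = env nd ->
  satisfies false idfun f (sl2_rels (Gen a) (Gen b) (Gen c) (Gen d)) ->
  sound (sl2_rules na nb nc nd).
Proof.
move=> Ea Eb Ec Ed /satisfiesE /=; rewrite Ea Eb Ec Ed.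
rewrite !(embD, embN, emb1, mulNr, mul1r).
move=> [h1 [h2 [h3 [h4 [h5 [h6 [h7 _]]]]]]].
have h8 : env na * env nd = 1 + emb qV * (env nb * env nc).
  by rewrite -h7 subrK.
do !split=> //.
- exact: mulV_flip (par_qqV P) h3.
- exact: mulV_flip (par_qqV P) h4.
- rewrite /= -[LHS](subKr (1 + emb qV * (env nb * env nc))) -{2}h8.
  by rewrite h5 mulrDl mulNr opprB addrACA subrr addr0.
Qed.

Lemma link_sound (X : Type) (f : X -> A) (a b c d a' b' c' d' : X)
    (na nb nc nd na' nb' nc' nd' : nat) :
  f a = env na -> f b = env nb -> f c = env nc -> f d = env nd ->
  f a' = env na' -> f b' = env nb' -> f c' = env nc' -> f d' = env nd' ->
  satisfies false idfun f (link_rels (Gen a) (Gen b) (Gen c) (Gen d)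
    (Gen a') (Gen b') (Gen c') (Gen d')) ->
  sound (link_rules na nb nc nd na' nb' nc' nd').
Proof.
move=> Ea Eb Ec Ed Ea' Eb' Ec' Ed' /satisfiesE /=.
rewrite Ea Eb Ec Ed Ea' Eb' Ec' Ed'.
move=> [h1 [h2 [h3 [h4 [h5 [h6 [h7 [h8 [h9 [hA [hB [hC [hD [hE [hF [hG _]]]]]]]]]]]]]]]].
do !split=> //; exact: mulV_flip lV_l _.
Qed.

Lemma minkowski_sound (f : 'I_2 * 'I_2 -> A) (n11 n12 n21 n22 : nat) :
  f (ord0, ord0) = env n11 -> f (ord0, ord_max) = env n12 ->
  f (ord_max, ord0) = env n21 -> f (ord_max, ord_max) = env n22 ->
  satisfies false idfun f minkowski_rels ->
  sound (minkowski_rules n11 n12 n21 n22).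
Proof.
move=> E11 E12 E21 E22 /satisfiesE /=; rewrite E11 E12 E21 E22.
move=> [h1 [h2 [h3 [h4 [h5 [h6 _]]]]]].
do !split=> //.
- by rewrite h3 embM embD embN.
- by rewrite h5 embM.
- rewrite -embM; apply: mulV_flip h6.
  by rewrite mulrACA qV_q par_llV mulr1.
- rewrite -embM; apply: mulV_flip h1.
  by rewrite mulrACA qV_q lV_l mulr1.
- by rewrite h2 embM.
Qed.

End Soundness.

Lemma mx2E (T : Type) (x11 x12 x21 x22 : T) :
  (mx2 x11 x12 x21 x22 ord0 ord0 = x11) *
  (mx2 x11 x12 x21 x22 ord0 ord_max = x12) *
  (mx2 x11 x12 x21 x22 ord_max ord0 = x21) *
  (mx2 x11 x12 x21 x22 ord_max ord_max = x22).
Proof. by []. Qed.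

Lemma conj_qV : par_conj qV = qV.
Proof.
have E : par_conj qV * q = 1.
  by rewrite -[X in _ * X]conj_q -rmorphM [_ * q]mulrC par_qqV rmorph1.
by rewrite -[LHS]mulr1 -(par_qqV P) mulrA E mul1r.
Qed.
Lemma conj_lV : par_conj lV = lV.
Proof.
have E : par_conj lV * l = 1.
  by rewrite -[X in _ * X]conj_l -rmorphM [_ * l]mulrC par_llV rmorph1.
by rewrite -[LHS]mulr1 -(par_llV P) mulrA E mul1r.
Qed.

Definition linked_env (n : nat) : linkedSL2 :=
  nth 0 [:: x_ ord0 ord0; x_ ord0 ord_max; x_ ord_max ord0; x_ ord_max ord_max;
            y_ ord0 ord0; y_ ord0 ord_max; y_ ord_max ord0; y_ ord_max ord_max]
    n.

Definition minkowski_env (n : nat) : minkowski :=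
  nth 0 [:: t_ ord0 ord0; t_ ord0 ord_max; t_ ord_max ord0; t_ ord_max ord_max]
    n.

Definition tensor_env (n : nat) : tensor linkedSL2 minkowski :=
  if (n < 8)%N then pure (linked_env n) 1 else pure 1 (minkowski_env (n - 8)).

Definition commute_rules : rules :=
  [seq (i, j, RMul (RLetter j) (RLetter i)) | i <- iota 8 4, j <- iota 0 8].

Lemma linked_sound : rules_sound q qV l lV linked_env linked_rules.
Proof.
have /satisfies_cat[h1 /satisfies_cat[h2 h3]] :=
  gen_satisfies (R := linked_rels).
apply: rules_sound_cat; first exact: sl2_sound h1.
apply: rules_sound_cat; first exact: sl2_sound h2.
exact: link_sound h3.
Qed.

Lemma minkowski_self_sound :
  rules_sound q qV l lV minkowski_env (minkowski_rules 0 1 2 3).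
Proof. exact: minkowski_sound (gen_satisfies (R := minkowski_rels)). Qed.

Lemma pure_homl (k' : comPzRingType) (A B : algebraType k') :
  algebra_hom (fun a : A => pure a (1 : B)).
Proof.
split=> // [|a a']; last by rewrite pureM mulr1.
by split=> [a a'|c a]; [exact: pureDl | exact: pureZl].
Qed.
Lemma pure_homr (k' : comPzRingType) (A B : algebraType k') :
  algebra_hom (fun b : B => pure (1 : A) b).
Proof.
split=> // [|b b']; last by rewrite pureM mulr1.
by split=> [b b'|c b]; [exact: pureDr | rewrite -pureZ pureZl].
Qed.

Lemma tensor_sound : rules_sound q qV l lV tensor_env
  (linked_rules ++ minkowski_rules 8 9 10 11 ++ commute_rules).
Proof.
have /satisfies_cat[h1 /satisfies_cat[h2 h3]] :=
  satisfies_hom (pure_homl linkedSL2 minkowski)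
    (gen_satisfies (R := linked_rels)).
have h4 := satisfies_hom (pure_homr linkedSL2 minkowski)
    (gen_satisfies (R := minkowski_rels)).
apply: rules_sound_cat.
  apply: rules_sound_cat; first exact: sl2_sound h1.
  apply: rules_sound_cat; first exact: sl2_sound h2.
  exact: link_sound h3.
apply: rules_sound_cat; first exact: minkowski_sound h4.
by rewrite /=; do !split; rewrite /tensor_env /= !pureM !(mulr1, mul1r).
Qed.

End LinkedAlgebras.

Ltac index_of x L :=
  match L with
  | x :: _ => constr:(0%N)
  | _ :: ?L' => let n := index_of x L' in constr:(S n)
  end.
Ltac reify L t :=
  match t with
  | emb (par_q _) => constr:(RQ)
  | emb (par_qV _) => constr:(RQV)
  | emb (par_l _) => constr:(RL)
  | emb (par_lV _) => constr:(RLV)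
  | ?u + ?v => let u' := reify L u in let v' := reify L v in
               constr:(RAdd u' v')
  | ?u * ?v => let u' := reify L u in let v' := reify L v in
               constr:(RMul u' v')
  | - ?u => let u' := reify L u in constr:(ROpp u')
  | 1 => constr:(ROne)
  | _ => let n := index_of t L in constr:(RLetter n)
  end.
Ltac decide_eq L sound :=
  match goal with
  | |- ?u = ?v =>
    let u' := reify L u in let v' := reify L v in
    apply: (check_eq (@par_qqV _) (@par_llV _) (n := 200) (t1 := u') (t2 := v')
              sound);
    vm_compute; reflexivity
  end.

Section WellDefined.
Variable P : parameters.
Local Notation x := (@x_ P).
Local Notation y := (@y_ P).
Local Notation t := (@t_ P).

Lemma antipode_satisfies :
  satisfies true idfun (@antipode_gen P) (linked_rels P).
Proof.
apply/satisfiesE; rewrite /= !mx2E /scale !(embD, embN, embM, emb1).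
do !split;
 decide_eq [:: x ord0 ord0; x ord0 ord_max; x ord_max ord0; x ord_max ord_max;
            y ord0 ord0; y ord0 ord_max; y ord_max ord0; y ord_max ord_max]
  (@linked_sound P).
Qed.

Lemma antipode_x i j : antipode (x i j) = antipode_gen P (GenX i j).
Proof. exact: extend_gen antipode_satisfies _. Qed.
Lemma antipode_y i j : antipode (y i j) = antipode_gen P (GenY i j).
Proof. exact: extend_gen antipode_satisfies _. Qed.

Lemma star_l_satisfies :
  satisfies true par_conj (@star_l_gen P) (linked_rels P).
Proof.
apply/satisfiesE; rewrite /= !(antipode_x, antipode_y) /= !mx2E /scale.
rewrite !(rmorphD, rmorphN, rmorphM, rmorph1, conj_q, conj_l, conj_qV, conj_lV).
rewrite !(embD, embN, embM, emb1).
do !split;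
 decide_eq [:: x ord0 ord0; x ord0 ord_max; x ord_max ord0; x ord_max ord_max;
            y ord0 ord0; y ord0 ord_max; y ord_max ord0; y ord_max ord_max]
  (@linked_sound P).
Qed.

Lemma star_m_satisfies :
  satisfies true par_conj (fun g => t g.2 g.1) (minkowski_rels P).
Proof.
apply/satisfiesE; rewrite /=.
rewrite !(rmorphD, rmorphN, rmorphM, rmorph1, conj_q, conj_l, conj_qV, conj_lV).
rewrite !(embD, embN, embM, emb1).
do !split;
 decide_eq [:: t ord0 ord0; t ord0 ord_max; t ord_max ord0; t ord_max ord_max]
  (@minkowski_self_sound P).
Qed.

Lemma rho_satisfies :
  satisfies false idfun (@rho_gen P) (minkowski_rels P).
Proof.
have pE (a : linkedSL2 P) (b : minkowski P) : pure a b = pure a 1 * pure 1 b.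
  by rewrite pureM mulr1 mul1r.
have pM (a b : linkedSL2 P) :
    pure (a * b) (1 : minkowski P) = pure a 1 * pure b 1.
  by rewrite pureM mulr1.
have pS c : pure (emb c : linkedSL2 P) (1 : minkowski P) = emb c by [].
have pN (a : linkedSL2 P) : pure (- a) (1 : minkowski P) = - pure a 1.
  apply: (addIr (pure a 1)); rewrite -pureDl !addNr.
  by rewrite -[X in pure X]emb0 pS emb0.
have rE g : rho_gen P g =
    (pure (y g.1 ord0 * antipode (x ord0 g.2)) (t ord0 ord0) +
     pure (y g.1 ord0 * antipode (x ord_max g.2)) (t ord0 ord_max)) +
    (pure (y g.1 ord_max * antipode (x ord0 g.2)) (t ord_max ord0) +
     pure (y g.1 ord_max * antipode (x ord_max g.2)) (t ord_max ord_max)).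
  have e : lift ord0 ord0 = ord_max :> 'I_2 by apply: val_inj.
  by rewrite /rho_gen !big_ord_recl !big_ord0 !addr0 !e.
have r11 := rE (ord0, ord0); have r12 := rE (ord0, ord_max).
have r21 := rE (ord_max, ord0); have r22 := rE (ord_max, ord_max).
move: r11 r12 r21 r22; rewrite /= !antipode_x /= !mx2E /scale.
move=> r11 r12 r21 r22.
apply/satisfiesE; rewrite /= r11 r12 r21 r22.
rewrite ![pure (_ * _) (t _ _)]pE !pM !(embN, pN) !pS.
rewrite !(embD, embN, embM, emb1).
pose pX i j := pure (x i j) (1 : minkowski P).
pose pY i j := pure (y i j) (1 : minkowski P).
pose pT i j := pure (1 : linkedSL2 P) (t i j).
have eX i j : pure (x i j) 1 = pX i j by [].
have eY i j : pure (y i j) 1 = pY i j by [].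
have eT i j : pure 1 (t i j) = pT i j by [].
rewrite !(eX, eY, eT).
do !split;
 decide_eq
   [:: pX ord0 ord0; pX ord0 ord_max; pX ord_max ord0; pX ord_max ord_max;
       pY ord0 ord0; pY ord0 ord_max; pY ord_max ord0; pY ord_max ord_max;
       pT ord0 ord0; pT ord0 ord_max; pT ord_max ord0; pT ord_max ord_max]
   (@tensor_sound P).
Qed.

Lemma antipode_antihom (u v : linkedSL2 P) :
  antipode (u * v) = antipode v * antipode u.
Proof. exact: extendM antipode_satisfies _ _. Qed.

Lemma star_l_x i j : star_l (x i j) = antipode (y j i).
Proof. exact: extend_gen star_l_satisfies _. Qed.
Lemma star_l_y i j : star_l (y i j) = antipode (x j i).
Proof. exact: extend_gen star_l_satisfies _. Qed.
Lemma star_m_t i j : star_m (t i j) = t j i.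
Proof. exact: extend_gen star_m_satisfies _. Qed.
Lemma rho_t i j : rho (t i j) =
  \sum_(s < 2) \sum_(r < 2) pure (y i s * antipode (x r j)) (t s r).
Proof. exact: extend_gen rho_satisfies _. Qed.

Lemma rho_hom : algebra_hom (@rho P).
Proof.
split; first exact: extend_semilinear rho_satisfies.
- exact: extendM rho_satisfies.
- exact: extend1 rho_satisfies.
Qed.

Lemma star_l_scale c (u : linkedSL2 P) : star_l (c *' u) = par_conj c *' star_l u.
Proof. by have [_] := extend_semilinear star_l_satisfies; apply. Qed.

Lemma star_l_star : star_structure par_conj (@star_l P).
Proof.
split; first exact: extend_semilinear star_l_satisfies.
- exact: extendM star_l_satisfies.
- exact: extend1 star_l_satisfies.
- move=> u; elim/presented_ind: u => [c|g|u v hu hv|u v hu hv].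
  + by rewrite /star_l !(extend_emb star_l_satisfies) conjK.
  + have qVq (z : linkedSL2 P) : (par_qV P) *' ((par_q P) *' z) = z.
      by rewrite /scale mulrA -embM [_ * par_q P]mulrC par_qqV emb1 mul1r.
    have qqV (z : linkedSL2 P) : (par_q P) *' ((par_qV P) *' z) = z.
      by rewrite /scale mulrA -embM par_qqV emb1 mul1r.
    have sN c d (z : linkedSL2 P) : (- c) *' ((- d) *' z) = c *' (d *' z).
      by rewrite /scale !embN !mulNr mulrN opprK.
    have cE : (par_conj (- par_q P) = - par_q P) * (par_conj (- par_qV P) = - par_qV P).
      by rewrite !rmorphN /= conj_q conj_qV.
    case: g => i j; rewrite -?/(x i j) -?/(y i j) ?(star_l_x, star_l_y);
    rewrite ?(antipode_x, antipode_y) /=; move: i j; apply: forall_mx2;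
    by rewrite !mx2E ?star_l_scale ?(star_l_x, star_l_y)
       ?(antipode_x, antipode_y) /= !mx2E ?cE ?sN ?qqV ?qVq.
  + by rewrite /star_l !(extendD star_l_satisfies) -!/(star_l _) hu hv.
  + by rewrite /star_l !(extendM star_l_satisfies) -!/(star_l _) hu hv.
Qed.

Lemma star_m_star : star_structure par_conj (@star_m P).
Proof.
split; first exact: extend_semilinear star_m_satisfies.
- exact: extendM star_m_satisfies.
- exact: extend1 star_m_satisfies.
- move=> u; elim/presented_ind: u => [c|[i j]|u v hu hv|u v hu hv].
  + by rewrite /star_m !(extend_emb star_m_satisfies) conjK.
  + by rewrite -/(t i j) !star_m_t.
  + by rewrite /star_m !(extendD star_m_satisfies) -!/(star_m _) hu hv.
  + by rewrite /star_m !(extendM star_m_satisfies) -!/(star_m _) hu hv.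
Qed.

Lemma star_lm_pure u v :
  tensor_map (@star_l P) (@star_m P) (pure u v) = pure (star_l u) (star_m v).
Proof.
by have [hl _ _ _] := star_l_star; have [hm _ _ _] := star_m_star;
   rewrite (tensor_map_pure hl hm).
Qed.

End WellDefined.

(* Main.v *)
Require Import Defs.
From mathcomp Require Import all_boot all_order all_algebra.
From mathcomp Require Import boolp reals.
From mathcomp Require Import complex.

(** Both sides are antilinear and antimultiplicative, so it suffices to compare
    them on the generators [t_ij].  Since [S(x_rj)] is the star of [y_jr] and
    stars are involutive, the star of [y_is S(x_rj)] is [y_jr S(x_si)]: the
    right-hand side at [t_ij] is the double sum defining [rho (t_ji)], with its
    two summation indices exchanged. *)

Import GRing.Theory.
Local Open Scope ring_scope.

Section TensorMap.
Set Implicit Arguments.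
Variables (k : comPzRingType) (A A' B B' : algebraType k) (sigma : k -> k).
Variables (f : A -> A') (g : B -> B').
Hypotheses (Hf : semilinear_map sigma f) (Hg : semilinear_map sigma g).

Lemma tensor_map0 : tensor_map f g 0 = 0.
Proof. exact: tensor_lift0 (tensor_map_balanced Hf Hg). Qed.

Lemma tensor_map_sum (I : Type) (s : seq I) (F : I -> tensor A B) :
  tensor_map f g (\sum_(i <- s) F i) = \sum_(i <- s) tensor_map f g (F i).
Proof.
exact: (big_morph _ (tensor_mapD Hf Hg) tensor_map0).
Qed.

(** Both sides are additive in [x] and in [y], which reduces the claim to pure tensors. There
    multiplication is componentwise, so reversing the order in each factor reverses the product. *)
Lemma tensor_map_antiM :
  (forall x y, f (x * y) = f y * f x) -> (forall x y, g (x * y) = g y * g x) ->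
  forall x y, tensor_map f g (x * y) = tensor_map f g y * tensor_map f g x.
Proof.
move=> fM gM x y; elim/tensor_ind: x => [|a b|x x' hx hx'].
- by rewrite mul0r tensor_map0 mulr0.
- elim/tensor_ind: y => [|a' b'|y y' hy hy'].
  + by rewrite mulr0 tensor_map0 mul0r.
  + by rewrite pureM !(tensor_map_pure Hf Hg) fM gM pureM.
  + by rewrite mulrDr !(tensor_mapD Hf Hg) hy hy' mulrDl.
- by rewrite mulrDl !(tensor_mapD Hf Hg) hx hx' mulrDr.
Qed.
End TensorMap.

Section Covariance.
Variable P : parameters.

Lemma star_l_antipode_x i j : star_l (antipode (x_ P i j)) = y_ P j i.
Proof. by have [_ _ _ K] := star_l_star P; rewrite -star_l_y K. Qed.

Lemma rho_star_m_t i j :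
  rho (star_m (t_ P i j)) = tensor_map (@star_l P) (@star_m P) (rho (t_ P i j)).
Proof.
have [lS lM _ _] := star_l_star P; have [mS _ _ _] := star_m_star P.
rewrite star_m_t !rho_t exchange_big (tensor_map_sum lS mS).
apply: eq_bigr => s _; rewrite (tensor_map_sum lS mS); apply: eq_bigr => r _.
by rewrite star_lm_pure lM star_l_antipode_x star_l_y star_m_t.
Qed.

Lemma rho_star_m :
  @rho P \o @star_m P =1 tensor_map (@star_l P) (@star_m P) \o @rho P.
Proof.
have [lS lM _ _] := star_l_star P; have [mS mM m1 _] := star_m_star P.
have [[rD _] rM _] := rho_hom P.
move=> u /=; elim/presented_ind: u => [c|[i j]|u v hu hv|u v hu hv].
(* The scalar [c] of the tensor product is [pure (emb c) 1], so [star_l] alone conjugates it. *)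
- rewrite /star_m (extend_emb (@star_m_satisfies P)) -/(@star_m P).
  rewrite !(algebra_hom_emb _ (rho_hom P)) [X in tensor_map _ _ X]/emb /=.
  rewrite star_lm_pure m1.
  by rewrite /star_l (extend_emb (@star_l_satisfies P)).
- exact: rho_star_m_t.
- by rewrite rD (tensor_mapD lS mS) -hu -hv; have [mD _] := mS; rewrite mD rD.
(* As [rho] preserves the order of factors, each side reverses it exactly once. *)
- by rewrite mM !rM (tensor_map_antiM lS mS lM mM) hu hv.
Qed.
End Covariance.

(** The covariance holds over every ground ring whose involutive conjugation fixes the invertible
    parameters; the two conjuncts are its cases of nonzero real numbers and of indeterminates. *)
Theorem proposition6p5 (R : realType) :
  (forall (q l : R) (Hq : q != 0) (Hl : l != 0),
     let P := complex_parameters Hq Hl in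
     @rho P \o @star_m P =1 tensor_map (@star_l P) (@star_m P) \o @rho P) /\
  (let P := laurent_parameters R in
   @rho P \o @star_m P =1 tensor_map (@star_l P) (@star_m P) \o @rho P).
Proof. by split=> [q l Hq Hl|] P; exact: rho_star_m. Qed.
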